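(* Let $f\in\mathbb C\langle X,Y\rangle$ be cyclically sorted. Suppose $\pi(f)\ge 0$ on $[-1,1]^2$. Then for all real $\varepsilon>0$, $f+\varepsilon$ is cyclically equivalent to an element of $M_{\mathbb R}$.
   Context: $\mathbb C\langle X,Y\rangle$ is the free associative unital $\mathbb C$-algebra in two noncommuting variables, and $\pi:\mathbb C\langle X,Y\rangle\to\mathbb C[X,Y]$ is the canonical ring epimorphism onto the commutative polynomial ring (letting the variables commute). Two polynomials $f,g\in\mathbb C\langle X,Y\rangle$ are cyclically equivalent if $f-g$ is a sum of commutators $pq-qp$ in $\mathbb C\langle X,Y\rangle$. A word $w$ in the letters $X,Y$ is cyclically sorted if it is cyclically equivalent to $X^iY^j$ for some integers $i,j\ge 0$; a polynomial is cyclically sorted if it is a linear combination of cyclically sorted words. $\mathbb R\langle X,Y\rangle$ carries the $\mathbb R$-linear involution $*$ fixing $X,Y$ and reversing words. $M_{\mathbb R}$ is the quadratic module generated by $1-X^2$ and $1-Y^2$ in $\mathbb R\langle X,Y\rangle$, i.e., the smallest set $M$ of symmetric elements ($g^*=g$) containing $1$, $1-X^2$, $1-Y^2$ with $M+M\subseteq M$ and $g^*Mg\subseteq M$ for all $g\in\mathbb R\langle X,Y\rangle$. A statement $c\ge0$ for complex $c$ includes that $c$ is real. *)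

(* Defs.v *)
From mathcomp Require Export all_boot all_order all_algebra.
From mathcomp Require Export finmap monalg mpoly complex reals.

Set Implicit Arguments.
Unset Strict Implicit.
Unset Printing Implicit Defensive.

Import Order.TTheory GRing.Theory Num.Theory.

Local Open Scope ring_scope.
Local Open Scope complex_scope.

(* The free unital algebra K<X,Y>: the algebra of the free monoid on two
   letters; ord0 is the letter X and ord_max the letter Y. *)
Definition word := {fmonom 'I_2}.
Definition freealg (K : nzRingType) := {malg K[word]}.

Definition ncX (K : nzRingType) : freealg K := << fmu (ord0 : 'I_2) >>.
Definition ncY (K : nzRingType) : freealg K := << fmu (ord_max : 'I_2) >>.

(* pi : K<X,Y> -> K[X,Y]; 'X_ord0 and 'X_ord_max are the images of X and Y.
   (The files monalg and mpoly both export a constant called mmap.) *)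
Definition ncpi (K : comNzRingType) (f : freealg K) : mpoly 2 K :=
  monalg.mmap (@mpolyC 2 K) (fun w : word => \prod_(i <- w) 'X_i) f.

Definition rpoint (R : realType) (a b : R) : 'I_2 -> R[i] :=
  fun i => if i == ord0 then a%:C else b%:C.

Definition cyc_equiv (K : nzRingType) (f g : freealg K) : Prop :=
  exists s : seq (freealg K * freealg K),
    f - g = \sum_(pq <- s) (pq.1 * pq.2 - pq.2 * pq.1).

Definition cyc_sorted_word (K : nzRingType) (w : word) : Prop :=
  exists i j : nat, cyc_equiv (<< w >> : freealg K) (ncX K ^+ i * ncY K ^+ j).

Definition cyc_sorted (K : nzRingType) (f : freealg K) : Prop :=
  exists s : seq (K * word),
    (forall cw, cw \in s -> cyc_sorted_word K cw.2) /\
    f = \sum_(cw <- s) cw.1 *: (<< cw.2 >> : freealg K).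

(* Word reversal, extended K-linearly. *)
Definition ncstar (K : nzRingType) (f : freealg K) : freealg K :=
  monalg.mmap (fun c : K => c *: (1 : freealg K))
       (fun w : word => << FMonom (rev w) >> : freealg K) f.

Record is_quadratic_module (K : nzRingType) (M : freealg K -> Prop) : Prop := {
  qm_sym : forall m, M m -> ncstar m = m;
  qm_one : M 1;
  qm_add : forall m n, M m -> M n -> M (m + n);
  qm_conj : forall g m, M m -> M (ncstar g * m * g)
}.

Definition quadratic_module_gen (K : nzRingType) (S : seq (freealg K))
    (m : freealg K) : Prop :=
  forall M : freealg K -> Prop,
    is_quadratic_module M -> (forall s, s \in S -> M s) -> M m.

Definition M_R (R : realType) : freealg R -> Prop :=
  quadratic_module_gen [:: 1 - ncX R ^+ 2; 1 - ncY R ^+ 2].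

(* The inclusion of R<X,Y> into C<X,Y>. *)
Definition nc_complexify (R : realType) (f : freealg R) : freealg R[i] :=
  monalg.mmap (fun c : R => c%:C *: (1 : freealg R[i]))
       (fun w : word => << w >> : freealg R[i]) f.

(* Main.v *)
From HB Require Import structures.
Require Import Defs.
From mathcomp Require Import all_boot all_order all_algebra.
From mathcomp Require Import finmap monalg mpoly complex reals.
From mathcomp Require Import ring lra.

(** The trace does not see commutators, so work in the convex cone of the
    elements cyclically equivalent to an element of [M_R], here called
    tracially positive. Up to commutators a cyclically sorted [f] is a sum of
    terms [C_ij X^i Y^j], where [sum C_ij x^i y^j] is the commutative image
    of [f]. This image is real on the square, so the [C_ij] are real, and it
    remains to put [p(X, Y) + eps] in the cone, where [p(x, y)] is a real
    polynomial nonnegative on the square and all [X] are written to the left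
    of all [Y].

    Two kinds of elements of the cone suffice. First,
    [s(X)^2 t(Y)^2] is cyclically equivalent to [g^* g] with [g = s(X) t(Y)]
    (lemma [tracially_positive_squares]). Second, the identity
      [2 + e (A B + B A) = |A + e B|^2 + (1 - A^2) + (1 - B^2)]
    with [A = X^i], [B = Y^j] and [e] a sign shows that
    [c + q(X, Y)] is in the cone whenever [c] is at least the sum of the
    absolute values of the coefficients of [q]
    (lemma [tracially_positive_coef_norm] for [q = u(x) v(y)]). Hence small
    errors, measured in the [l^1] norm of coefficients, can be absorbed in
    [eps], and [u(X) v(Y) + eps] is in the cone as soon as [u] and [v] are
    limits of squares in that norm (lemma
    [tracially_positive_approx_squares]).

    Such limits are closed under products, and they contain [1 - x] and
    [1 + x]: the iteration [r |-> (z + r^2) / 2] produces approximations of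
    [1 - sqrt (1 - z)] that converge in norm, by comparison with the same
    iteration at [z = 1] (lemma [approx_square_1sub]). Therefore every
    Bernstein polynomial, a product of powers of [(1 + x) / 2] and
    [(1 - x) / 2], is a limit of squares.

    Finally, [p] is exactly a combination of products of Bernstein polynomials
    in [x] and in [y], with coefficients that converge uniformly to values of
    [p] on the square as the level grows (lemma [bernstein_coefs]). Adding a
    small positive constant makes these coefficients nonnegative, and [p]
    becomes a nonnegative combination of products of limits of squares. *)

Set Implicit Arguments.
Unset Strict Implicit.
Unset Printing Implicit Defensive.

Import Order.TTheory GRing.Theory Num.Theory.

Local Open Scope ring_scope.
Local Open Scope complex_scope.

(** * Words and cyclic equivalence *)

Section FreeAlgebra.

Variable K : comNzRingType.
Implicit Types (f g h : freealg K) (c : K) (i : 'I_2) (w : word).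

(** Scalars are central; this is what makes the evaluation of a univariate
    polynomial at an element of the free algebra a ring morphism. *)
Lemma malgC_comm f : commr_rmorph (@malgC word K) f.
Proof.
move=> c; rewrite /GRing.comm (monalgE f) mulr_sumr mulr_suml.
apply: eq_bigr => w _; rewrite malgM_def malgM_def !fgmulUU.
by rewrite mul1m mulm1 mulrC.
Qed.

(** The free algebra is only a left algebra by construction; centrality of the
    scalars gives the other half of the axioms of an algebra. *)
Lemma freealg_scalerAr c f g : c *: (f * g) = f * (c *: g).
Proof. by rewrite -!mul_malgC !mulrA malgC_comm. Qed.

Lemma freealg_mulZZ c d f g : c *: f * (d *: g) = (c * d) *: (f * g).
Proof. by rewrite -scalerA (freealg_scalerAr d); exact: esym (fgscaleAl _ _ _). Qed.

Lemma wordM w1 w2 : << mmul w1 w2 >> = << w1 >> * << w2 >> :> freealg K.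
Proof. by rewrite malgM_def fgmulUU mulr1. Qed.

Lemma word1 : << mone >> = 1 :> freealg K.
Proof. by []. Qed.

Lemma letterX i n : << fmu i >> ^+ n = << FMonom (nseq n i) >> :> freealg K.
Proof.
elim: n => [|n IH]; first by rewrite expr0 -word1 /=; congr << _ >>; rewrite -fmoneE.
rewrite exprS IH -wordM; congr << _ >>.
by apply/eqP; rewrite fmP fmM fmU.
Qed.

Lemma XYword i j n m :
  << fmu i >> ^+ n * << fmu j >> ^+ m
    = << FMonom (nseq n i ++ nseq m j) >> :> freealg K.
Proof.
rewrite !letterX -wordM; congr << _ >>.
by apply/eqP; rewrite fmP fmM.
Qed.

Lemma cyc_equiv_refl f : cyc_equiv f f.
Proof. by exists [::]; rewrite big_nil subrr. Qed.

Lemma cyc_equivD f1 f2 g1 g2 :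
  cyc_equiv f1 g1 -> cyc_equiv f2 g2 -> cyc_equiv (f1 + f2) (g1 + g2).
Proof. by move=> [s1 E1] [s2 E2]; exists (s1 ++ s2); rewrite big_cat -E1 -E2 opprD addrACA. Qed.

Lemma cyc_equiv_trans f g h : cyc_equiv f g -> cyc_equiv g h -> cyc_equiv f h.
Proof. by move=> [s1 E1] [s2 E2]; exists (s1 ++ s2); rewrite big_cat -E1 -E2 /= addrA subrK. Qed.

Lemma cyc_equivZ c f g : cyc_equiv f g -> cyc_equiv (c *: f) (c *: g).
Proof.
move=> [s E]; exists [seq (c *: pq.1, pq.2) | pq <- s].
rewrite -scalerBr E scaler_sumr big_map; apply: eq_bigr => pq _ /=.
rewrite scalerBr; congr (_ - _); first exact: fgscaleAl.
exact: freealg_scalerAr.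
Qed.

Lemma cyc_equiv_mulC f g : cyc_equiv (f * g) (g * f).
Proof. by exists [:: (f, g)]; rewrite big_seq1. Qed.

(** The general theory of [mmap] applies once the scalars are embedded through
    the additive map [malgC]. *)
Lemma ncstarE f : ncstar f =
  monalg.mmap (@malgC word K) (fun w : word => << FMonom (rev w) >> : freealg K) f.
Proof.
by rewrite /ncstar !monalg.mmapE; apply: eq_bigr => w _; rewrite -mul_malgC mulr1.
Qed.

Lemma ncstarD f g : ncstar (f + g) = ncstar f + ncstar g.
Proof. by rewrite !ncstarE monalg.mmapD. Qed.

Lemma ncstarU c w : ncstar (c *: << w >>) = c *: << FMonom (rev w) >>.
Proof.
have -> : c *: << w >> = << c *g w >> :> freealg K.
  by rewrite -mul_malgC malgM_def fgmulUU mulr1 mul1m.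
by rewrite ncstarE monalg.mmapU mul_malgC.
Qed.

Lemma ncstar_XY c i j n m :
  ncstar (c *: (<< fmu i >> ^+ n * << fmu j >> ^+ m))
    = c *: (<< fmu j >> ^+ m * << fmu i >> ^+ n).
Proof. by rewrite !XYword ncstarU /= rev_cat !rev_nseq. Qed.

End FreeAlgebra.

(** * The cone of tracially positive elements *)

Section LmodIdentities.

Variables (R : realType) (V : lmodType R).

Lemma scaler_halves (e : R) (p : V) : e *: p = (e / 2) *: p + (e / 2) *: p.
Proof. by rewrite -scalerDl -splitr. Qed.

(** The expansion of [|A + e B|^2 + (1 - A^2) + (1 - B^2)] with [u = A^2],
    [v = B^2], [p = A B], [q = B A]: the squares cancel. *)
Lemma square_average (e : R) (o u v p q : V) :
  2^-1 *: (u + e *: p + (e *: q + v) + (o - u) + (o - v))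
    = o + ((e / 2) *: p + (e / 2) *: q).
Proof.
rewrite (AC (2*2*2*2) ((1*6)*(4*8)*(5*7)*(2*3))) /=.
rewrite !subrr !add0r scalerDr -mulr2n -scaler_nat scalerA mulVf ?pnatr_eq0 //.
by rewrite scale1r -scalerDr scalerA mulrC scalerDr.
Qed.

Lemma scaler_sign_split (c a : R) (o w : V) :
  c *: o + a *: w = (c - `|a|) *: o + `|a| *: (o + Num.sg a *: w).
Proof.
by rewrite scalerDr scalerA addrA -scalerDl subrK [_ * Num.sg a]mulrC -numEsg.
Qed.

End LmodIdentities.

Section TracialPositivity.

Variable R : realType.
Implicit Types (f g m : freealg R) (c : R) (i : 'I_2).

Lemma M_R_one : M_R (1 : freealg R).
Proof. by move=> M Mqm _; apply: qm_one. Qed.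

Lemma M_RD m1 m2 : M_R m1 -> M_R m2 -> M_R (m1 + m2).
Proof. by move=> M1 M2 M Mqm sM; exact: (qm_add Mqm (M1 _ Mqm sM) (M2 _ Mqm sM)). Qed.

Lemma M_R_conj g m : M_R m -> M_R (ncstar g * m * g).
Proof. by move=> Mm M Mqm sM; exact: (qm_conj Mqm g (Mm _ Mqm sM)). Qed.

(** A nonnegative scalar acts as conjugation by its square root. *)
Lemma M_RZ c m : 0 <= c -> M_R m -> M_R (c *: m).
Proof.
move=> c0 Mm; have := @M_R_conj (Num.sqrt c *: << mone >>) _ Mm.
rewrite ncstarU (_ : FMonom _ = mone); last by apply/eqP; rewrite fmP /= fm1.
rewrite word1 -freealg_scalerAr -!fgscaleAl scalerA mulr1 mul1r.
by rewrite -expr2 sqr_sqrtr.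
Qed.

Lemma M_R_letter i : M_R (1 - << fmu i >> ^+ 2 : freealg R).
Proof.
move=> M _; apply; rewrite !inE /ncX /ncY.
have [->|i0] := eqVneq i ord0; first by apply/orP; left; apply/eqP.
have -> : i = ord_max by case: i i0 => [[|[|n]] lt2] // _; apply/val_inj.
by apply/orP; right; apply/eqP.
Qed.

Lemma ncstar_letterX i n : ncstar (<< fmu i >> ^+ n) = << fmu i >> ^+ n :> freealg R.
Proof.
have := @ncstar_XY R 1 i i n 0.
by rewrite expr0 mulr1 mul1r !scale1r.
Qed.

(** Telescoping: [1 - x^(2n+2) = x^n (1 - x^2) x^n + (1 - x^(2n))]. *)
Lemma M_R_even_power i n : M_R (1 - << fmu i >> ^+ n ^+ 2 : freealg R).
Proof.
elim: n => [|n IH]; first by rewrite expr0 expr1n subrr -[0](scale0r 1); apply: M_RZ => //; exact: M_R_one.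
have := M_RD (M_R_conj (<< fmu i >> ^+ n) (M_R_letter i)) IH.
rewrite ncstar_letterX; move: << fmu i >> => x.
have -> : x ^+ n.+1 ^+ 2 = x ^+ n * x ^+ 2 * x ^+ n.
  by rewrite -!exprD -exprM; congr (_ ^+ _); ring.
by rewrite mulrBr mulr1 mulrBl -expr2 addrC addrA subrK.
Qed.

(** The convex cone obtained from [M_R] by adding all sums of commutators. *)
Definition tracially_positive f := exists2 m, M_R m & cyc_equiv f m.

Lemma tracially_positiveD f g :
  tracially_positive f -> tracially_positive g -> tracially_positive (f + g).
Proof.
move=> [m1 M1 e1] [m2 M2 e2]; exists (m1 + m2); first exact: M_RD.
exact: cyc_equivD.
Qed.

Lemma tracially_positiveZ c f :
  0 <= c -> tracially_positive f -> tracially_positive (c *: f).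
Proof.
by move=> c0 [m M1 e]; exists (c *: m); [exact: M_RZ|exact: cyc_equivZ].
Qed.

Lemma tracially_positive_const c : 0 <= c -> tracially_positive (c *: 1).
Proof.
move=> c0; apply: tracially_positiveZ => //; exists 1; first exact: M_R_one.
exact: cyc_equiv_refl.
Qed.

Lemma tracially_positive_sum (I : Type) (r : seq I) (F : I -> freealg R) :
  (forall k, tracially_positive (F k)) ->
  tracially_positive (\sum_(k <- r) F k).
Proof.
move=> FG; elim/big_ind: _ => //; last by move=> *; apply: tracially_positiveD.
by rewrite -[0](scale0r 1); exact: tracially_positive_const.
Qed.

(** For a sign [e], half of [|A + e B|^2 + (1 - A^2) + (1 - B^2)] lies in [M_R]
    and equals [1 + e (A B + B A) / 2], where [B A] may be replaced by [A B]. *)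
Lemma tracially_positive_1_sign (e : R) i j n k : e ^+ 2 = 1 ->
  tracially_positive (1 + e *: (<< fmu i >> ^+ n * << fmu j >> ^+ k)).
Proof.
move=> e1; set A := << fmu i >> ^+ n; set B := << fmu j >> ^+ k.
exists (2^-1 *: (ncstar (A + e *: B) * 1 * (A + e *: B)
                 + (1 - A ^+ 2) + (1 - B ^+ 2))).
  apply: M_RZ; first by rewrite invr_ge0.
  apply: M_RD; last exact: M_R_even_power.
  apply: M_RD; last exact: M_R_even_power.
  by apply: M_R_conj; exact: M_R_one.
have -> : ncstar (A + e *: B) = A + e *: B.
  rewrite ncstarD ncstar_letterX; congr (_ + _).
  by have := @ncstar_XY R e j j k 0; rewrite expr0 mulr1 mul1r.
have -> : 2^-1 *: ((A + e *: B) * 1 * (A + e *: B) + (1 - A ^+ 2) + (1 - B ^+ 2))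
   = 1 + ((e / 2) *: (A * B) + (e / 2) *: (B * A)).
  rewrite mulr1 mulrDl !mulrDr -!freealg_scalerAr -!fgscaleAl scalerA -!expr2 e1.
  by rewrite scale1r; exact: square_average.
apply: cyc_equivD; first exact: cyc_equiv_refl.
rewrite [e *: (A * B)]scaler_halves.
apply: cyc_equivD; first exact: cyc_equiv_refl.
exact/cyc_equivZ/cyc_equiv_mulC.
Qed.

(** The archimedean property of the cone: every monomial [X^n Y^k] is
    bounded by 1 in the order that the cone defines. *)
Lemma tracially_positive_monomial (c a : R) i j n k : `|a| <= c ->
  tracially_positive (c *: 1 + a *: (<< fmu i >> ^+ n * << fmu j >> ^+ k)).
Proof.
move=> ac; have [->|a0] := eqVneq a 0.
  by rewrite scale0r addr0; apply: tracially_positive_const; apply: le_trans ac.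
rewrite scaler_sign_split.
apply: tracially_positiveD; first by apply: tracially_positive_const; rewrite subr_ge0.
by apply/tracially_positiveZ/tracially_positive_1_sign => //; rewrite sqr_sg a0.
Qed.

End TracialPositivity.

(** * The coefficient norm and polynomials in one letter *)

Section CoefNorm.

Variable R : realDomainType.
Implicit Types (p q u v : {poly R}) (c : R).

(** The [l^1] norm of the coefficients. *)
Definition coef_norm p := \sum_(k < size p) `|p`_k|.

Lemma coef_normE n p : (size p <= n)%N -> coef_norm p = \sum_(k < n) `|p`_k|.
Proof.
move=> le_n; rewrite /coef_norm (big_ord_widen n (fun k => `|p`_k|) le_n) big_mkcond.
apply: eq_bigr => k _; case: ltnP => // /(nth_default 0) ->.
by rewrite normr0.
Qed.

Lemma coef_norm_ge0 p : 0 <= coef_norm p.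
Proof. by apply: sumr_ge0. Qed.

Lemma coef_norm0 : coef_norm 0 = 0.
Proof. by rewrite /coef_norm size_poly0 big_ord0. Qed.

Lemma coef_normD p q : coef_norm (p + q) <= coef_norm p + coef_norm q.
Proof.
set n := maxn (size p) (size q).
rewrite (@coef_normE n _ (size_polyD _ _)) (@coef_normE n p) ?leq_maxl // (@coef_normE n q) ?leq_maxr //.
rewrite -big_split; apply: ler_sum => k _ /=.
by rewrite coefD ler_normD.
Qed.

Lemma coef_normZ c p : coef_norm (c *: p) = `|c| * coef_norm p.
Proof.
rewrite (@coef_normE (size p)) ?size_scale_leq // /coef_norm mulr_sumr.
by apply: eq_bigr => k _; rewrite coefZ normrM.
Qed.

Lemma coef_normN p : coef_norm (- p) = coef_norm p.
Proof. by rewrite -scaleN1r coef_normZ normrN1 mul1r. Qed.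

Lemma coef_normXM p : coef_norm ('X * p) <= coef_norm p.
Proof.
rewrite (@coef_normE (size p).+1); last first.
  by apply: leq_trans (size_polyMleq _ _) _; rewrite size_polyX.
rewrite big_ord_recl coefXM /= normr0 add0r /coef_norm.
by under eq_bigr => k _ do rewrite coefXM /=.
Qed.

Lemma coef_normXnM n p : coef_norm ('X^n * p) <= coef_norm p.
Proof.
elim: n => [|n IH]; first by rewrite expr0 mul1r.
by rewrite exprS -mulrA; apply: le_trans (coef_normXM _) IH.
Qed.

Lemma coef_norm_sum (I : Type) (r : seq I) (F : I -> {poly R}) :
  coef_norm (\sum_(k <- r) F k) <= \sum_(k <- r) coef_norm (F k).
Proof.
elim/big_ind2: _ => //; first by rewrite coef_norm0.
by move=> p1 c1 p2 c2 h1 h2; apply: le_trans (coef_normD _ _) (lerD h1 h2).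
Qed.

Lemma coef_normM p q : coef_norm (p * q) <= coef_norm p * coef_norm q.
Proof.
rewrite -{1}(coefK p) poly_def mulr_suml.
apply: le_trans (coef_norm_sum _ _) _; rewrite [coef_norm p]/coef_norm mulr_suml.
apply: ler_sum => k _; rewrite -scalerAl coef_normZ.
by apply: ler_wpM2l (coef_normXnM _ _).
Qed.

Lemma coef_normX : coef_norm 'X = 1.
Proof.
by rewrite /coef_norm size_polyX 2!big_ord_recl big_ord0 !coefX /= normr0 normr1 add0r addr0.
Qed.

End CoefNorm.

Section PolynomialsInALetter.

Variable K : comNzRingType.
Implicit Types (u v : {poly K}) (i j : 'I_2).

Definition letter_poly i : {poly K} -> freealg K :=
  horner_morph (malgC_comm (<< fmu i >> : freealg K)).

HB.instance Definition _ i := GRing.RMorphism.on (letter_poly i).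

Lemma letter_polyX i : letter_poly i 'X = << fmu i >>.
Proof. exact: horner_morphX. Qed.

Lemma letter_polyC i c : letter_poly i c%:P = malgC c.
Proof. exact: horner_morphC. Qed.

Lemma letter_polyXn i n : letter_poly i 'X^n = << fmu i >> ^+ n.
Proof. by rewrite rmorphXn /= letter_polyX. Qed.

Lemma letter_polyZ i c u : letter_poly i (c *: u) = c *: letter_poly i u.
Proof. by rewrite -mul_polyC rmorphM /= letter_polyC mul_malgC. Qed.

Lemma letter_polyE i u :
  letter_poly i u = \sum_(k < size u) u`_k *: << fmu i >> ^+ k.
Proof.
rewrite -{1}(coefK u) poly_def raddf_sum; apply: eq_bigr => k _.
by rewrite /= letter_polyZ letter_polyXn.
Qed.

Lemma letter_polyME i j u v :
  letter_poly i u * letter_poly j v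
    = \sum_(k < size u) \sum_(l < size v)
        (u`_k * v`_l) *: (<< fmu i >> ^+ k * << fmu j >> ^+ l).
Proof.
rewrite !letter_polyE mulr_suml; apply: eq_bigr => k _.
rewrite mulr_sumr; apply: eq_bigr => l _.
by rewrite -freealg_scalerAr -fgscaleAl scalerA mulrC.
Qed.

Lemma ncstar_sum (I : Type) (r : seq I) (F : I -> freealg K) :
  ncstar (\sum_(k <- r) F k) = \sum_(k <- r) ncstar (F k).
Proof.
apply: (big_morph _ (@ncstarD K)).
by rewrite -[0](scale0r (<< mone >> : freealg K)) ncstarU !scale0r.
Qed.

(** Both factors are self-adjoint, so the involution exchanges them. *)
Lemma ncstar_letter_polyM i j u v :
  ncstar (letter_poly i u * letter_poly j v) = letter_poly j v * letter_poly i u.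
Proof.
rewrite !letter_polyME ncstar_sum exchange_big /=; apply: eq_bigr => k _.
rewrite ncstar_sum; apply: eq_bigr => l _.
by rewrite ncstar_XY mulrC.
Qed.

End PolynomialsInALetter.

Section TracialProducts.

Variable R : realType.
Implicit Types (u v s t : {poly R}) (i j : 'I_2).

(** The error estimate of the whole argument: an error term is absorbed by a
    scalar as soon as its coefficients are small, whatever its degree. *)
Lemma tracially_positive_coef_norm i j u v :
  tracially_positive ((coef_norm u * coef_norm v) *: 1 + letter_poly i u * letter_poly j v).
Proof.
rewrite letter_polyME {1}/coef_norm mulr_suml scaler_suml -big_split.
apply: tracially_positive_sum => k; rewrite /= {1}/coef_norm mulr_sumr scaler_suml -big_split.
by apply: tracially_positive_sum => l; apply: tracially_positive_monomial; rewrite normrM.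
Qed.

Lemma squares_sandwichE (A : pzRingType) (a b : A) :
  a ^+ 2 * b ^+ 2 - b * a * 1 * (a * b) = a * a * b * b - b * (a * a * b).
Proof. by rewrite mulr1 !expr2 !mulrA. Qed.

Lemma cyc_equiv_squares (a b : freealg R) :
  cyc_equiv (a ^+ 2 * b ^+ 2) (b * a * 1 * (a * b)).
Proof. by exists [:: (a * a * b, b)]; rewrite big_seq1; exact: squares_sandwichE. Qed.

(** [s(X)^2 t(Y)^2] is cyclically equivalent to the hermitian square of
    [s(X) t(Y)]. This is where cyclic sortedness enters: all powers of [X]
    stand next to each other. *)
Lemma tracially_positive_squares i j s t :
  tracially_positive (letter_poly i (s ^+ 2) * letter_poly j (t ^+ 2)).
Proof.
pose g := letter_poly i s * letter_poly j t.
exists (ncstar g * 1 * g); first by apply: M_R_conj; exact: M_R_one.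
rewrite ncstar_letter_polyM !rmorphXn /=; exact: cyc_equiv_squares.
Qed.

End TracialProducts.

(** * Limits of squares in the coefficient norm *)

Section ApproximateSquares.

Variable R : realType.
Implicit Types (p q u v s t z : {poly R}) (c d : R) (n : nat).

(** Approximation is in the coefficient norm, with no bound on the degree
    of [s]; a polynomial that is nonnegative only on [[-1, 1]] can qualify. *)
Definition approx_square u :=
  forall d, 0 < d -> exists s, coef_norm (u - s ^+ 2) <= d.

Lemma approx_square_sqr s : approx_square (s ^+ 2).
Proof. by move=> d d0; exists s; rewrite subrr coef_norm0 ltW. Qed.

(** With [c] the norm of a cofactor, an error of [d / (c + 1)] costs at most
    [d] after multiplication by it; adding 1 avoids a division by zero. *)
Lemma share_le c d : 0 <= c -> 0 <= d -> d / (c + 1) * c <= d.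
Proof. by move=> c0 d0; rewrite mulrAC ler_pdivrMr ?ltr_wpDl // mulrDr mulr1 lerDl. Qed.

Lemma approx_squareM u v : approx_square u -> approx_square v -> approx_square (u * v).
Proof.
move=> hu hv d d0.
have Nv0 := coef_norm_ge0 v.
have [|s hs] := hu (d / 2 / (coef_norm v + 1)); first by rewrite !divr_gt0 // ltr_wpDl.
have Ns0 := coef_norm_ge0 (s ^+ 2).
have [|t ht] := hv (d / 2 / (coef_norm (s ^+ 2) + 1)); first by rewrite !divr_gt0 // ltr_wpDl.
exists (s * t).
have -> : u * v - (s * t) ^+ 2 = (u - s ^+ 2) * v + s ^+ 2 * (v - t ^+ 2) by ring.
apply: le_trans (coef_normD _ _) _; rewrite [leRHS](splitr d); apply: lerD.
  apply: le_trans (coef_normM _ _) _; apply: le_trans (ler_wpM2r Nv0 hs) _.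
  by apply: share_le => //; rewrite divr_ge0 // ltW.
apply: le_trans (coef_normM _ _) _; apply: le_trans (ler_wpM2l Ns0 ht) _.
by rewrite mulrC; apply: share_le => //; rewrite divr_ge0 // ltW.
Qed.

Lemma approx_square_const c : 0 <= c -> approx_square c%:P.
Proof. by move=> c0; rewrite -(sqr_sqrtr c0) polyC_exp; exact: approx_square_sqr. Qed.

Lemma approx_squareX u n : approx_square u -> approx_square (u ^+ n).
Proof.
move=> hu; elim: n => [|n IH]; last by rewrite exprS; exact: approx_squareM.
by rewrite expr0 -(expr1n _ 2); exact: approx_square_sqr.
Qed.

(** The iteration [r |-> (z + r^2) / 2], whose limit is [1 - sqrt (1 - z)].
    The factor 1/2 is an argument because the recursion is run both in the
    ring of polynomials, which is not a field, and in the real field. *)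
Fixpoint visser (A : pzRingType) (half z : A) n : A :=
  if n is n'.+1 then half * (z + visser half z n' ^+ 2) else 0.

(** At [z = 1] the gap [b = 1 - a] follows [b |-> b - b^2 / 2], which decays
    like [2 / n]. *)
Lemma visser1_bounds n :
  let a := visser 2^-1 (1 : R) n in 0 <= a <= 1 /\ (1 - a) * n.+2%:R <= 2.
Proof.
elim: n => [|n [/andP[a0 a1] ha]] /=.
  by rewrite lexx ler01 subr0 mul1r.
set a := visser _ _ n in a0 a1 ha *.
have a2 : a ^+ 2 <= 1 by rewrite expr_le1.
have a20 : 0 <= a ^+ 2 by rewrite exprn_ge0.
have n0 : 0 <= n%:R :> R by [].
rewrite -[n.+3%:R]natr1 -[n.+2%:R]natr1 -[n.+1%:R]natr1 in ha *.
move: (n%:R : R) n0 ha => x n0 ha; split; first by apply/andP; split; lra.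
have -> : 1 - 2^-1 * (1 + a ^+ 2) = (1 - a) * (1 - (1 - a) / 2) by field.
have : 0 <= 1 - a by lra.
move: (1 - a) ha => b ha b0.
have : b * (x + 1 + 1) * b <= 2 * b by apply: ler_wpM2r.
nra.
Qed.

(** The real iteration at [z = 1] majorizes the polynomial one, because the
    coefficient norm is submultiplicative and the recursion has nonnegative
    coefficients. *)
Lemma coef_norm_visser z n : coef_norm z <= 1 ->
  let r := visser (2^-1)%:P z in let a := visser 2^-1 (1 : R) in
  coef_norm (r n) <= a n /\ coef_norm (r n.+1 - r n) <= a n.+1 - a n.
Proof.
move=> z1 r a.
have h0 : 0 <= 2^-1 :> R by rewrite invr_ge0.
have half p c : coef_norm p <= c -> coef_norm ((2^-1)%:P * p) <= 2^-1 * c.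
  by move=> pc; rewrite mul_polyC coef_normZ ger0_norm // ler_wpM2l.
have rS m : r m.+1 = (2^-1)%:P * (z + r m ^+ 2) by [].
have aS m : a m.+1 = 2^-1 * (1 + a m ^+ 2) by [].
have step m : coef_norm (r m) <= a m -> coef_norm (r m.+1) <= a m.+1.
  move=> ra; rewrite rS aS; apply: half; apply: le_trans (coef_normD _ _) _.
  apply: lerD => //; rewrite !expr2; apply: le_trans (coef_normM _ _) _.
  by apply: ler_pM => //; exact: coef_norm_ge0.
elim: n => [|n [IHr IHd]]; first split.
- by rewrite /r /a /= coef_norm0.
- by rewrite /r /a /= !subr0 !expr0n /= !addr0; apply: half.
split; first exact: step.
rewrite [r n.+2]rS [a n.+2]aS {2}rS {2}aS -!mulrBr; apply: half.
have subKl (A : zmodType) (x y t : A) : t + x - (t + y) = x - y.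
  by rewrite opprD addrACA subrr add0r.
rewrite !subKl !subr_sqr.
apply: le_trans (coef_normM _ _) _; apply: ler_pM => //; try exact: coef_norm_ge0.
by apply: le_trans (coef_normD _ _) _; apply: lerD => //; exact: step.
Qed.

(** Since [(1 - z) - (1 - r_n)^2 = 2 (r_n - r_(n+1))], the defect of [1 - r_n]
    as a square root of [1 - z] is a step of the iteration, and the steps
    tend to 0 in norm. *)
Lemma approx_square_1sub z : coef_norm z <= 1 -> approx_square (1 - z).
Proof.
move=> z1 d d0; pose n := Num.truncn (2 / d).
have [/andP[a0 a1] a2] := visser1_bounds n.
have [_ rn] := coef_norm_visser n z1.
exists (1 - visser (2^-1)%:P z n).
have -> : 1 - z - (1 - visser (2^-1)%:P z n) ^+ 2
    = (- 2)%:P * (visser (2^-1)%:P z n.+1 - visser (2^-1)%:P z n).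
  rewrite /=; set r := visser _ _ n.
  rewrite mulrBr mulrA -polyCM mulNr divff ?pnatr_eq0 //.
  rewrite polyCN polyCN polyC1 rmorph_nat; ring.
rewrite mul_polyC coef_normZ normrN ger0_norm //.
apply: le_trans (ler_wpM2l _ rn) _ => //=.
set a := visser _ _ n in a0 a1 a2 *.
have nd : 2 / d < n.+1%:R by exact: truncnS_gt.
rewrite ltr_pdivrMr // in nd.
rewrite -natr1 in a2; move: (n.+1%:R : R) nd a2 => x nd a2.
(* The step of the real iteration is half the square of the gap to 1. *)
have -> : 2 * (2^-1 * (1 + a ^+ 2) - a) = (1 - a) ^+ 2 by field.
have x0 : 0 < x by nra.
have a3 : (1 - a) * x <= x * d by nra.
have : (1 - a) <= d by rewrite -(ler_pM2r x0) [leRHS]mulrC.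
by apply: le_trans; rewrite expr2; nra.
Qed.

End ApproximateSquares.

(** * Bernstein polynomials *)

Section ProductOfApproximateSquares.

(** The splitting of [a b] into the product [a' b'] of approximations and two
    error terms, each completed by a scalar that dominates it. *)
Lemma product_errorE (R : pzRingType) (A : lalgType R) (e c d : R) (a b a' b' : A) :
  e *: 1 + a * b = a' * b' + (c *: 1 + (a - a') * b) + (d *: 1 + a' * (b - b'))
                   + (e - c - d) *: 1.
Proof.
rewrite !scalerBl mulrBl mulrBr.
move: (a * b) (a' * b') (a' * b) (e *: 1) (c *: 1) (d *: 1) => p q r x y z.
rewrite (AC (1*(1*2)*(1*2)*3) ((8*3)*(1*7)*(2*9)*(4*6)*(5*10))) /=.
by rewrite !subrr addNr !addr0.
Qed.

(** Replace both factors by squares; the coefficient norm bounds the error. *)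
Lemma tracially_positive_approx_squares (R : realType) (u v : {poly R}) i j eps :
  approx_square u -> approx_square v -> 0 < eps ->
  tracially_positive (eps *: 1 + letter_poly i u * letter_poly j v).
Proof.
move=> hu hv e0; have Nv0 := coef_norm_ge0 v.
have e20 : 0 <= eps / 2 by rewrite divr_ge0 // ltW.
have [|s hs] := hu (eps / 2 / (coef_norm v + 1)); first by rewrite !divr_gt0 // ltr_wpDl.
have Ns0 := coef_norm_ge0 (s ^+ 2).
have [|t ht] := hv (eps / 2 / (coef_norm (s ^+ 2) + 1)); first by rewrite !divr_gt0 // ltr_wpDl.
rewrite (product_errorE eps (coef_norm (u - s ^+ 2) * coef_norm v)
  (coef_norm (s ^+ 2) * coef_norm (v - t ^+ 2)) _ _
  (letter_poly i (s ^+ 2)) (letter_poly j (t ^+ 2))).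
rewrite -!raddfB; apply: tracially_positiveD; first apply: tracially_positiveD.
- apply: tracially_positiveD; first exact: tracially_positive_squares.
  exact: tracially_positive_coef_norm.
- exact: tracially_positive_coef_norm.
apply: tracially_positive_const.
have h1 := le_trans (ler_wpM2r Nv0 hs) (share_le Nv0 e20).
have h2 := le_trans (ler_wpM2r Ns0 ht) (share_le Ns0 e20).
by rewrite [coef_norm (s ^+ 2) * _]mulrC; lra.
Qed.

End ProductOfApproximateSquares.

Section Bernstein.

Variable R : realType.
Implicit Types (p q w : {poly R}) (n k : nat).

Lemma coef_norm_horner p (x : R) : `|x| <= 1 -> `|p.[x]| <= coef_norm p.
Proof.
move=> x1; rewrite horner_coef; apply: le_trans (ler_norm_sum _ _ _) _.
by apply: ler_sum => k _; rewrite normrM ler_piMr // normrX exprn_ile1.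
Qed.

Lemma poly_lipschitz p : exists2 L : R, 0 <= L &
  forall a b, `|a| <= 1 -> `|b| <= 1 -> `|p.[a] - p.[b]| <= L * `|a - b|.
Proof.
elim/poly_ind: p => [|p c [L L0 hL]].
  by exists 0 => // a b _ _; rewrite !horner0 subrr normr0 mul0r.
exists (L + coef_norm p) => [|a b a1 b1]; first by rewrite addr_ge0 ?coef_norm_ge0.
rewrite !hornerMXaddC.
have -> : p.[a] * a + c - (p.[b] * b + c) = (p.[a] - p.[b]) * a + p.[b] * (a - b).
  by ring.
apply: le_trans (ler_normD _ _) _; rewrite !normrM mulrDl; apply: lerD.
  by apply: le_trans (hL _ _ a1 b1); rewrite ler_piMr.
by rewrite ler_wpM2r // coef_norm_horner.
Qed.

(** The affine coordinate that maps [[-1, 1]] onto [[0, 1]]. *)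
Definition halfX : {poly R} := 2^-1 *: (1 + 'X).

Definition bernstein n k : {poly R} :=
  'C(n, k)%:R *: (halfX ^+ k * (1 - halfX) ^+ (n - k)).

Lemma approx_square_bernstein n k : approx_square (bernstein n k).
Proof.
have half z : coef_norm z <= 1 -> approx_square (2^-1 *: (1 - z) : {poly R}).
  move=> z1; rewrite -mul_polyC; apply: approx_squareM.
    by apply: approx_square_const; rewrite invr_ge0.
  exact: approx_square_1sub.
rewrite /bernstein -mul_polyC; apply: approx_squareM; first exact: approx_square_const.
apply: approx_squareM; apply: approx_squareX.
  by rewrite /halfX -['X]opprK; apply: half; rewrite coef_normN coef_normX.
have -> : 1 - halfX = 2^-1 *: (1 - 'X).
  by rewrite /halfX -!mul_polyC -[1]/(1%:P) {1}[1]splitr mul1r !polyCD; ring.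
by apply: half; rewrite coef_normX.
Qed.

Lemma sum_bernstein n : \sum_(k < n.+1) bernstein n k = 1.
Proof.
have := exprDn (1 - halfX) halfX n; rewrite subrK expr1n => ->.
by apply: eq_bigr => k _; rewrite /bernstein scaler_nat mulrC.
Qed.

Lemma halfX_bernstein n k :
  halfX * bernstein n k = (k.+1%:R / n.+1%:R) *: bernstein n.+1 k.+1.
Proof.
rewrite /bernstein scalerA -scalerAr mulrA -exprS subSS; congr (_ *: _).
by rewrite mulrAC -natrM -(mul_bin_diag n.+1 k) natrM mulrAC divff ?mul1r ?pnatr_eq0.
Qed.

(** The Bernstein coefficients of a polynomial at level [n] converge uniformly
    to its values at the nodes [k / n], while the expansion itself is exact.
    Multiplication by the coordinate sends the coefficient [c_(k-1)] at level
    [n] to [k / (n+1) * c_(k-1)] at level [n+1]; the nodes move by at most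
    [1 / n], which the Lipschitz bound absorbs. *)
Lemma bernstein_coefs q (d : R) : 0 < d -> exists N, forall n, (N <= n)%N ->
  exists2 c : nat -> R,
    q \Po halfX = \sum_(k < n.+1) c k *: bernstein n k &
    forall k, (k <= n)%N -> `|c k - q.[k%:R / n%:R]| <= d.
Proof.
elim/poly_ind: q d => [|q a IH] d d0.
  exists 0%N => n _; exists (fun=> 0) => [|k _]; last by rewrite horner0 subrr normr0 ltW.
  by rewrite comp_poly0 big1 // => k _; rewrite scale0r.
have [N hN] := IH _ (divr_gt0 d0 (ltr0Sn R 1)).
have [L L0 hL] := poly_lipschitz q.
exists (maxn N (Num.truncn (2 * L / d)).+1).+1 => -[|n] //.
rewrite ltnS geq_max => /andP[/hN[c qE hc] nL].
have n1 : (0 < n)%N by apply: leq_trans nL.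
have n0 : 0 < n%:R :> R by rewrite ltr0n.
(* At k = 0 no product contributes; there 0.-1 = 0, and it is the factor k
   that makes the coefficient vanish. *)
exists (fun k => k%:R / n.+1%:R * c k.-1 + a).
  rewrite comp_polyD comp_polyM comp_polyX comp_polyC mulrC qE.
  under [RHS]eq_bigr => k _ do rewrite scalerDl.
  rewrite big_split /= -scaler_sumr sum_bernstein alg_polyC; congr (_ + _).
  rewrite [RHS]big_ord_recl !mul0r scale0r add0r mulr_sumr; apply: eq_bigr => k _.
  by rewrite -scalerAr halfX_bernstein scalerA mulrC.
move=> [_|k kn] /=.
  by rewrite !mul0r hornerMXaddC mulr0 add0r subrr normr0 ltW.
rewrite hornerMXaddC opprD addrACA subrr addr0 [q.[_] * _]mulrC -mulrBr.
set y := _ / _; have y1 : `|y| <= 1.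
  by rewrite ger0_norm ?divr_ge0 // ler_pdivrMr ?ltr0Sn // mul1r ler_nat.
have z1 : `|k%:R / n%:R : R| <= 1.
  by rewrite ger0_norm ?divr_ge0 // ler_pdivrMr // mul1r ler_nat.
rewrite normrM; apply: le_trans (ler_piMl _ y1) _ => //.
rewrite -(subrK q.[k%:R / n%:R] (c k)) -addrA.
apply: le_trans (ler_normD _ _) _; rewrite (splitr d); apply: lerD; first exact: hc.
apply: le_trans (hL _ _ z1 y1) _.
have yz : `|k%:R / n%:R - y| <= n%:R^-1.
  have -> : k%:R / n%:R - y = - (n%:R - k%:R) / n.+1%:R / n%:R.
    rewrite /y -[k.+1%:R]natr1 -[n.+1%:R]natr1; field.
    by rewrite natr1 !pnatr_eq0 -lt0n n1.
  rewrite normrM [X in _ * X]ger0_norm ?invr_ge0 // ler_piMl ?invr_ge0 //.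
  rewrite normrM normrN !ger0_norm ?invr_ge0 ?subr_ge0 ?ler_nat //.
  by rewrite ler_pdivrMr ?ltr0Sn // mul1r -natr1 lerBlDr -addrA ler_wpDr // addr_ge0.
apply: le_trans (ler_wpM2l L0 yz) _.
have : 2 * L / d < n%:R by apply: lt_le_trans (truncnS_gt _) _; rewrite ler_nat.
rewrite ltr_pdivrMr // ler_pdivrMr // => nd.
by rewrite -(ler_pM2l (ltr0Sn R 1)) mulrCA mulrA divfK ?pnatr_eq0 // [leRHS]mulrC ltW.
Qed.

End Bernstein.

(** * Real polynomials nonnegative on the square *)

Section PositiveOnTheSquare.

Variable R : realType.

Definition node n k : R := 2 * (k%:R / n%:R) - 1.

Lemma node_bounds n k : (k <= n)%N -> -1 <= node n k <= 1.
Proof.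
move=> kn; have : 0 <= k%:R / n%:R :> R by rewrite divr_ge0.
have : k%:R / n%:R <= 1 :> R.
  case: n kn => [|n] kn; first by rewrite invr0 mulr0.
  by rewrite ler_pdivrMr ?ltr0Sn // mul1r ler_nat.
by rewrite /node => h1 h2; apply/andP; split; lra.
Qed.

(** One level [n] serves all the exponents below [d]. *)
Lemma monomial_bernstein d (e : R) : 0 < e -> exists N, forall n, (N <= n)%N ->
  exists c : nat -> nat -> R, forall i, (i < d)%N ->
    'X^i = \sum_(k < n.+1) c i k *: bernstein R n k /\
    forall k, (k <= n)%N -> `|c i k - node n k ^+ i| <= e.
Proof.
move=> e0; elim: d => [|d [N hN]]; first by exists 0%N => n _; exists (fun _ _ => 0).
have [M hM] := bernstein_coefs ((2%:P * 'X - 1) ^+ d) e0.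
exists (maxn N M) => n; rewrite geq_max => /andP[/hN[c hc] /hM[c' c'E hc']].
exists (fun i => if i == d then c' else c i) => i.
rewrite ltnS leq_eqVlt; case: eqVneq => [-> _|_ /= /hc] //.
split=> [|k /hc']; last by rewrite horner_exp !hornerE /node mulrA.
rewrite -c'E rmorphXn /= rmorphB rmorphM /= comp_polyX comp_polyC rmorph1.
by rewrite /halfX -mul_polyC mulrA -polyCM divff ?pnatr_eq0 // mul1r addrAC subrr add0r.
Qed.

Lemma dist_mul_le (e a b x y : R) : 0 <= e <= 1 -> `|y| <= 1 -> `|x| <= 1 ->
  `|a - x| <= e -> `|b - y| <= e -> `|a * b - x * y| <= 3 * e.
Proof.
move=> /andP[e0 e1] y1 x1 ax bY.
have -> : a * b - x * y = (a - x) * (b - y) + (a - x) * y + x * (b - y) by ring.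
have h1 : `|(a - x) * (b - y)| <= e * 1.
  by rewrite normrM; apply: ler_pM => //; apply: le_trans bY e1.
have h2 : `|(a - x) * y| <= e * 1 by rewrite normrM; apply: ler_pM.
have h3 : `|x * (b - y)| <= 1 * e by rewrite normrM; apply: ler_pM.
have := ler_normD ((a - x) * (b - y) + (a - x) * y) (x * (b - y)).
have := ler_normD ((a - x) * (b - y)) ((a - x) * y).
lra.
Qed.

Lemma bernstein_product_expansion d n (A c : nat -> nat -> R) (i0 j0 : 'I_2) (e : R) :
  (forall i, (i < d)%N -> 'X^i = \sum_(k < n.+1) c i k *: bernstein R n k) ->
  e *: 1 + \sum_(i < d) \sum_(j < d) A i j *: (<< fmu i0 >> ^+ i * << fmu j0 >> ^+ j)
  = \sum_(k < n.+1) \sum_(l < n.+1)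
      (e + \sum_(i < d) \sum_(j < d) A i j * (c i k * c j l)) *:
      (letter_poly i0 (bernstein R n k) * letter_poly j0 (bernstein R n l))
   :> freealg R.
Proof.
move=> cE; under [RHS]eq_bigr => k _ do under eq_bigr => l _ do rewrite scalerDl.
under [RHS]eq_bigr => k _ do rewrite big_split /=.
rewrite big_split /=; congr (_ + _).
  under eq_bigr => k _ do rewrite -scaler_sumr -mulr_sumr -raddf_sum /= sum_bernstein rmorph1 mulr1.
  by rewrite -scaler_sumr -raddf_sum /= sum_bernstein rmorph1.
under [RHS]eq_bigr => k _ do under eq_bigr => l _ do rewrite scaler_suml.
under [RHS]eq_bigr => k _ do rewrite exchange_big /=.
rewrite [RHS]exchange_big /=; apply: eq_bigr => i _.
under [RHS]eq_bigr => k _ do under eq_bigr => l _ do rewrite scaler_suml.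
under [RHS]eq_bigr => k _ do rewrite exchange_big /=.
rewrite [RHS]exchange_big /=; apply: eq_bigr => j _.
under [RHS]eq_bigr => k _ do under eq_bigr => l _ do rewrite -scalerA.
under [RHS]eq_bigr => k _ do rewrite -scaler_sumr.
rewrite -scaler_sumr; apply: (congr1 (fun x => A i j *: x)).
rewrite -(letter_polyXn R i0) -(letter_polyXn R j0) (cE i) // (cE j) // !raddf_sum.
rewrite mulr_suml; apply: eq_bigr => k _; rewrite mulr_sumr; apply: eq_bigr => l _.
by rewrite /= !letter_polyZ freealg_mulZZ.
Qed.

(** Expand in products of Bernstein polynomials. The coefficients are close to
    values of the polynomial on the square, hence nonnegative once half of
    [eps] is added; the other half pays for the finitely many products, each
    of which is tracially positive up to an arbitrarily small scalar. *)
Lemma tracially_positive_on_square d (A : nat -> nat -> R) (i0 j0 : 'I_2) :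
  (forall a b : R, -1 <= a <= 1 -> -1 <= b <= 1 ->
     0 <= \sum_(i < d) \sum_(j < d) A i j * (a ^+ i * b ^+ j)) ->
  forall eps, 0 < eps -> tracially_positive
   (eps *: 1 + \sum_(i < d) \sum_(j < d)
      A i j *: (<< fmu i0 >> ^+ i * << fmu j0 >> ^+ j)).
Proof.
move=> A0 eps eps0.
have e20 : 0 < eps / 2 by rewrite divr_gt0.
pose S := \sum_(i < d) \sum_(j < d) `|A i j|.
have S0 : 0 <= S by apply: sumr_ge0 => i _; apply: sumr_ge0.
(* The coefficient of a product of Bernstein polynomials is off the value at
   the node by at most 3 e for each unit of S. *)
pose e := Num.min 1 (eps / 2 / (S + 1) / 3).
have e0 : 0 < e by rewrite lt_min ltr01 !divr_gt0 // ltr_wpDl.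
have eS : S * (3 * e) <= eps / 2.
  have : 3 * e <= eps / 2 / (S + 1) by rewrite mulrC -ler_pdivlMr // ge_min lexx orbT.
  move/(ler_wpM2l S0)/le_trans; apply; rewrite mulrC.
  by apply: share_le => //; exact: ltW.
have [n hn] := monomial_bernstein d e0; have {hn} [c hc] := hn n (leqnn n).
pose D k l := eps / 2 + \sum_(i < d) \sum_(j < d) A i j * (c i k * c j l).
have D0 (k l : 'I_n.+1) : 0 <= D k l.
  have := A0 _ _ (@node_bounds n k (ltn_ord k)) (@node_bounds n l (ltn_ord l)).
  set P := (X in 0 <= X) => P0.
  suff : P - \sum_(i < d) \sum_(j < d) A i j * (c i k * c j l) <= S * (3 * e).
    by rewrite /D; lra.
  rewrite /P -sumrB mulr_suml; apply: ler_sum => i _.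
  rewrite -sumrB mulr_suml; apply: ler_sum => j _.
  rewrite -mulrBr; apply: le_trans (ler_norm _) _; rewrite normrM ler_wpM2l //.
  rewrite distrC; have nod m : (m <= n)%N -> `|node n m| <= 1.
    by move/node_bounds; rewrite ler_norml.
  apply: dist_mul_le.
  - by rewrite ltW // ge_min lexx.
  - by rewrite normrX exprn_ile1 // nod // -ltnS.
  - by rewrite normrX exprn_ile1 // nod // -ltnS.
  - by have [_] := hc i (ltn_ord i); apply; rewrite -ltnS.
  - by have [_] := hc j (ltn_ord j); apply; rewrite -ltnS.
rewrite {1}(splitr eps) scalerDl -addrA.
rewrite (@bernstein_product_expansion d n A c) => [|i /hc[]//].
pose W := \sum_(k < n.+1) \sum_(l < n.+1) D k l.
have W0 : 0 <= W by apply: sumr_ge0 => k _; apply: sumr_ge0.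
(* The scalar spent on each product, before scaling by its coefficient. *)
pose h := eps / 2 / (W + 1).
have h0 : 0 < h by rewrite divr_gt0 // ltr_wpDl.
have hW : h * W <= eps / 2 by apply: share_le => //; exact: ltW.
have -> : (eps / 2) *: (1 : freealg R) = (eps / 2 - h * W) *: 1 + (h * W) *: 1.
  by rewrite -scalerDl subrK.
rewrite -addrA; apply: tracially_positiveD.
  by apply: tracially_positive_const; rewrite subr_ge0.
rewrite mulr_sumr scaler_suml -big_split; apply: tracially_positive_sum => k /=.
rewrite mulr_sumr scaler_suml -big_split; apply: tracially_positive_sum => l /=.
rewrite [h * _]mulrC -scalerA -scalerDr; apply: tracially_positiveZ => //.
by apply: tracially_positive_approx_squares => //; exact: approx_square_bernstein.
Qed.

End PositiveOnTheSquare.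

(** * Sorted form and ring morphisms *)

Section CyclicallySorted.

Variable K : comNzRingType.

Lemma grid_add_delta (V : lmodType K) d (F : nat -> nat -> V) c (C : nat -> nat -> K) i j :
  (i < d)%N -> (j < d)%N ->
  \sum_(k < d) \sum_(l < d) (c *+ ((k == i :> nat) && (l == j :> nat)) + C k l) *: F k l
    = c *: F i j + \sum_(k < d) \sum_(l < d) C k l *: F k l.
Proof.
move=> id jd; under eq_bigr => k _ do under eq_bigr => l _ do rewrite scalerDl.
under eq_bigr => k _ do rewrite big_split.
rewrite big_split; congr (_ + _) => /=.
rewrite (bigD1 (Ordinal id)) //= (bigD1 (Ordinal jd)) //= !eqxx.
rewrite big1 => [|l /negPf]; last by rewrite -val_eqE /= => ->; rewrite scale0r.
rewrite addr0 big1 ?addr0 // => k /negPf; rewrite -val_eqE /= => ->.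
by rewrite big1 // => l _; rewrite scale0r.
Qed.

(** Each word may be replaced by its sorted form; collecting equal exponents
    makes the coefficients those of the commutative image. *)
Lemma cyc_sorted_grid (f : freealg K) : cyc_sorted f ->
  exists d (C : nat -> nat -> K), cyc_equiv f
    (\sum_(i < d) \sum_(j < d) C i j *: (ncX K ^+ i * ncY K ^+ j)).
Proof.
case=> s [sorted_s ->]; rewrite /ncX /ncY.
(* Asking for every large d lets the induction compare grids of different
   sizes without padding. *)
suff [D hD] : exists D, forall d, (D <= d)%N -> exists C : nat -> nat -> K,
    cyc_equiv (\sum_(cw <- s) cw.1 *: (<< cw.2 >> : freealg K))
    (\sum_(i < d) \sum_(j < d) C i j *: (<< fmu ord0 >> ^+ i * << fmu ord_max >> ^+ j)).
  by exists D; exact: hD.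
elim: s sorted_s => [|[c w] s IH] sorted_s.
  exists 0%N => d _; exists (fun _ _ => 0); rewrite big_nil big1 => [|i _].
    exact: cyc_equiv_refl.
  by rewrite big1 // => j _; rewrite scale0r.
have [|D hD] := IH; first by move=> cw cws; apply: sorted_s; rewrite inE cws orbT.
have [i [j wij]] := sorted_s (c, w) (mem_head _ _).
exists (maxn D (maxn i j).+1) => d; rewrite !geq_max gtn_max => /and3P[/hD[C hC] id jd].
exists (fun k l => c *+ ((k == i) && (l == j)) + C k l); rewrite big_cons.
rewrite (grid_add_delta (fun i j => << fmu ord0 >> ^+ i * << fmu ord_max >> ^+ j : freealg K)) //.
apply: cyc_equivD hC; exact: cyc_equivZ.
Qed.

End CyclicallySorted.

Section Morphisms.

Lemma rmorph_commutator (A B : pzRingType) (phi : {rmorphism A -> B}) (a b : A) :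
  phi (a * b - b * a) = phi a * phi b - phi b * phi a.
Proof. by rewrite rmorphB !rmorphM. Qed.

(** Named so that it can carry the structure of a monoid morphism, as the
    theory of [mmap] requires; likewise for [word_mono]. *)
Definition word_elt (K : nzRingType) (w : word) : freealg K := << w >>.

Lemma word_elt_is_multiplicative (K : comNzRingType) : monalg.mmorphism (@word_elt K).
Proof. by split=> // w1 w2; exact: wordM. Qed.

HB.instance Definition _ (K : comNzRingType) :=
  monalg.isMultiplicative.Build word (freealg K) (@word_elt K)
    (word_elt_is_multiplicative K).

Definition word_mono (K : comNzRingType) (w : word) : (mpoly 2 K) :=
  \prod_(i <- w) 'X_i.

Lemma word_mono_is_multiplicative (K : comNzRingType) : monalg.mmorphism (@word_mono K).
Proof.
split=> [w1 w2|]; last by rewrite /word_mono fm1 big_nil.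
by rewrite /word_mono fmM big_cat.
Qed.

HB.instance Definition _ (K : comNzRingType) :=
  monalg.isMultiplicative.Build word (mpoly 2 K) (@word_mono K)
    (word_mono_is_multiplicative K).

Lemma ncpiE (K : comNzRingType) (f : freealg K) :
  ncpi f = monalg.mmap (@mpolyC 2 K) (@word_mono K) f.
Proof. by []. Qed.

Lemma ncpi_is_additive (K : comNzRingType) : additive (@ncpi K).
Proof. by move=> f g; rewrite !ncpiE; exact: raddfB. Qed.

Lemma ncpi_is_multiplicative (K : comNzRingType) : multiplicative (@ncpi K).
Proof. exact: (@monalg.mmap_is_multiplicative word K (mpoly 2 K) (@mpolyC 2 K) (@word_mono K)). Qed.

HB.instance Definition _ (K : comNzRingType) :=
  GRing.isAdditive.Build (freealg K) (mpoly 2 K) (@ncpi K) (@ncpi_is_additive K).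
HB.instance Definition _ (K : comNzRingType) :=
  GRing.isMultiplicative.Build (freealg K) (mpoly 2 K) (@ncpi K)
    (@ncpi_is_multiplicative K).

Lemma ncpi_cyc_equiv (K : comNzRingType) (f g : freealg K) :
  cyc_equiv f g -> ncpi f = ncpi g.
Proof.
case=> s E; apply/eqP; rewrite -subr_eq0 -rmorphB E rmorph_sum big1 // => pq _.
by rewrite (rmorph_commutator (@ncpi K)) [_ * ncpi pq.1]mulrC subrr.
Qed.

Lemma ncpi_letter (K : comNzRingType) i : ncpi (<< fmu i >> : freealg K) = 'X_i.
Proof.
have E : ncpi << fmu i >> = (1 : K)%:MP_[2] * word_mono K (fmu i) by exact: monalg.mmapU.
by rewrite E mpolyC1 mul1r /word_mono fmU big_seq1.
Qed.

Lemma ncpiZ (K : comNzRingType) c (f : freealg K) : ncpi (c *: f) = c *: ncpi f.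
Proof. by rewrite -mul_mpolyC !ncpiE; exact: monalg.mmapZ. Qed.

Variable R : realType.

(** The general theory of [mmap] applies once the scalar map is a composition of
    ring morphisms. *)
Lemma nc_complexifyE (f : freealg R) : nc_complexify f =
  monalg.mmap (@malgC word R[i] \o real_complex R) (@word_elt R[i]) f.
Proof.
rewrite /nc_complexify !monalg.mmapE; apply: eq_bigr => w _.
by rewrite -mul_malgC mulr1.
Qed.

Lemma nc_complexify_is_additive : additive (@nc_complexify R).
Proof. by move=> f g; rewrite !nc_complexifyE; exact: raddfB. Qed.

Lemma nc_complexify_is_multiplicative : multiplicative (@nc_complexify R).
Proof.
have comm (g : freealg R) (w w' : word) :
    GRing.comm ((@malgC word R[i] \o real_complex R) (monalg.mcoeff w g)) (@word_elt R[i] w').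
  by apply/commr_sym; exact: malgC_comm.
have [mM m1] := monalg.commr_mmap_is_multiplicative comm.
by split=> [f g|]; rewrite !nc_complexifyE; [exact: mM|exact: m1].
Qed.

HB.instance Definition _ :=
  GRing.isAdditive.Build (freealg R) (freealg R[i]) (@nc_complexify R)
    nc_complexify_is_additive.
HB.instance Definition _ :=
  GRing.isMultiplicative.Build (freealg R) (freealg R[i]) (@nc_complexify R)
    nc_complexify_is_multiplicative.

Lemma nc_complexify_letter i :
  nc_complexify (<< fmu i >> : freealg R) = << fmu i >>.
Proof.
have E : nc_complexify (<< fmu i >> : freealg R) = malgC (1 : R)%:C * << fmu i >>.
  by rewrite nc_complexifyE; exact: monalg.mmapU.
by rewrite E (rmorph1 (real_complex R)) (rmorph1 (@malgC word R[i])) mul1r.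
Qed.

Lemma nc_complexifyZ c (f : freealg R) :
  nc_complexify (c *: f) = c%:C *: nc_complexify f.
Proof. by rewrite -[RHS]mul_malgC !nc_complexifyE; exact: monalg.mmapZ. Qed.

Lemma cyc_equiv_complexify (f g : freealg R) :
  cyc_equiv f g -> cyc_equiv (nc_complexify f) (nc_complexify g).
Proof.
case=> s E; exists [seq (nc_complexify pq.1, nc_complexify pq.2) | pq <- s].
rewrite -rmorphB E rmorph_sum big_map; apply: eq_bigr => pq _ /=.
exact: rmorph_commutator.
Qed.

End Morphisms.

(** * Reality of the coefficients *)

Section RealCoefficients.

Variable R : realType.

(** The points [1 / (n + 1)] provide as many roots as needed. *)
Lemma poly_zero_on_interval (p : {poly R}) :
  (forall a, -1 <= a <= 1 -> p.[a] = 0) -> p = 0.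
Proof.
move=> p0; pose rs := [seq n.+1%:R^-1 : R | n <- iota 0 (size p)].
apply: (@roots_geq_poly_eq0 _ p rs); last by rewrite size_map size_iota.
  apply/allP => _ /mapP[n _ ->]; apply/eqP/p0.
  rewrite invf_le1 ?ltr0Sn // ler1n andbT.
  by apply: le_trans (_ : 0 <= _); rewrite ?invr_ge0 ?lerN10.
by rewrite map_inj_uniq ?iota_uniq // => n m /invr_inj/eqP; rewrite eqr_nat => /eqP[].
Qed.

(** A polynomial in two variables that vanishes on the square is zero: first
    as a polynomial in [a] for fixed [b], then coefficientwise in [b]. *)
Lemma grid_zero_on_square d (B : nat -> nat -> R) :
  (forall a b, -1 <= a <= 1 -> -1 <= b <= 1 ->
     \sum_(i < d) \sum_(j < d) B i j * (a ^+ i * b ^+ j) = 0) ->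
  forall i j, (i < d)%N -> (j < d)%N -> B i j = 0.
Proof.
move=> B0 i j id jd.
have col b : -1 <= b <= 1 -> \sum_(l < d) B i l * b ^+ l = 0.
  move=> b1; pose p := \poly_(k < d) \sum_(l < d) B k l * b ^+ l.
  suff p0 : p = 0 by have := coef_poly d (fun k => \sum_(l < d) B k l * b ^+ l) i; rewrite -/p p0 coef0 id.
  apply: poly_zero_on_interval => a a1; rewrite horner_poly -[RHS](B0 a b) //.
  apply: eq_bigr => k _; rewrite mulr_suml; apply: eq_bigr => l _; ring.
pose q := \poly_(l < d) B i l.
suff q0 : q = 0 by have := coef_poly d (B i) j; rewrite -/q q0 coef0 jd.
by apply: poly_zero_on_interval => b b1; rewrite horner_poly col.
Qed.

Lemma ReMreal (z : R[i]) (r : R) : complex.Re (z * r%:C) = complex.Re z * r.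
Proof. by case: z => x y /=; rewrite mulr0 subr0. Qed.

Lemma ImMreal (z : R[i]) (r : R) : complex.Im (z * r%:C) = complex.Im z * r.
Proof. by case: z => x y /=; rewrite mulr0 add0r. Qed.

Lemma Re_sum (I : Type) (s : seq I) (F : I -> R[i]) :
  complex.Re (\sum_(k <- s) F k) = \sum_(k <- s) complex.Re (F k).
Proof. by apply: (big_morph (@complex.Re R)) => // -[x y] [x' y']. Qed.

Lemma Im_sum (I : Type) (s : seq I) (F : I -> R[i]) :
  complex.Im (\sum_(k <- s) F k) = \sum_(k <- s) complex.Im (F k).
Proof. by apply: (big_morph (@complex.Im R)) => // -[x y] [x' y']. Qed.

Lemma ncpi_grid_eval d (C : nat -> nat -> R[i]) (a b : R) :
  (ncpi (\sum_(i < d) \sum_(j < d) C i j *: (ncX R[i] ^+ i * ncY R[i] ^+ j))).@[rpoint a b]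
  = \sum_(i < d) \sum_(j < d) C i j * (a ^+ i * b ^+ j)%:C.
Proof.
rewrite (rmorph_sum (@ncpi R[i])) (rmorph_sum (meval (rpoint a b))).
apply: eq_bigr => i _ /=.
rewrite (rmorph_sum (@ncpi R[i])) (rmorph_sum (meval (rpoint a b))).
apply: eq_bigr => j _ /=.
rewrite ncpiZ mevalZ rmorphM rmorphM !rmorphXn /= !ncpi_letter !mevalXU.
by rewrite /rpoint /= rmorphM !rmorphXn.
Qed.

End RealCoefficients.

Unset Implicit Arguments.

Theorem proposition4p2 (R : realType) (f : freealg R[i]) :
  cyc_sorted f ->
  (forall a b : R, -1 <= a <= 1 -> -1 <= b <= 1 ->
    0 <= (ncpi f).@[rpoint a b]) ->
  forall eps : R, 0 < eps ->
    exists2 m : freealg R, M_R m &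
      cyc_equiv (f + eps%:C *: 1) (nc_complexify m).
Proof.
move=> /cyc_sorted_grid[d [C fC]] f0 eps eps0.
have valE a b : -1 <= a <= 1 -> -1 <= b <= 1 ->
    0 <= \sum_(i < d) \sum_(j < d) C i j * (a ^+ i * b ^+ j)%:C.
  by move=> a1 b1; rewrite -ncpi_grid_eval -(ncpi_cyc_equiv fC); exact: f0.
have Im0 i j : (i < d)%N -> (j < d)%N -> complex.Im (C i j) = 0.
  move: i j; apply: (@grid_zero_on_square R d (fun i j => complex.Im (C i j))) => a b a1 b1.
  have := ger0_Im (valE a b a1 b1); rewrite Im_sum => E; rewrite -[RHS]E.
  apply: eq_bigr => i _; rewrite Im_sum; apply: eq_bigr => j _.
  by rewrite ImMreal.
have CE i j : (i < d)%N -> (j < d)%N -> (complex.Re (C i j))%:C = C i j.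
  by move=> id jd; apply/eqP; rewrite eq_complex /= Im0 // !eqxx.
have [|m Mm em] := @tracially_positive_on_square R d
    (fun i j => complex.Re (C i j)) ord0 ord_max _ eps eps0.
  move=> a b a1 b1; have := valE a b a1 b1; rewrite lecE => /andP[_].
  rewrite Re_sum; congr (_ <= _).
  apply: eq_bigr => i _; rewrite Re_sum; apply: eq_bigr => j _.
  by rewrite ReMreal.
exists m => //; apply: cyc_equiv_trans (cyc_equiv_complexify em).
rewrite rmorphD /= nc_complexifyZ rmorph1 addrC.
apply: cyc_equivD; first exact: cyc_equiv_refl.
suff -> : nc_complexify (\sum_(i < d) \sum_(j < d) complex.Re (C i j) *:
    (<< fmu ord0 >> ^+ i * << fmu ord_max >> ^+ j)) =
  \sum_(i < d) \sum_(j < d) C i j *: (ncX R[i] ^+ i * ncY R[i] ^+ j) by [].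
rewrite raddf_sum; apply: eq_bigr => i _; rewrite raddf_sum; apply: eq_bigr => j _.
rewrite /= nc_complexifyZ rmorphM !rmorphXn /= !nc_complexify_letter.
by rewrite CE.
Qed.
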